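(* Let $k,d$ be positive integers, let $\chi \geq 2$ be an integer, and let $G$ be a $(p,\lambda)$-pseudo-random graph on $n$ vertices with $0 <p \leq 3/4$ and $$\lambda \leq \left(\Big(\frac{p}{10k}\Big)^d2^{-pk}\right)^{20\log \chi}n.$$ Then every $d$-degenerate graph on $k$ vertices with chromatic number at most $\chi$ occurs as an induced monochromatic copy in every $2$-coloring of the edges of $G$. Moreover, all of these induced monochromatic copies can be found in the same color (that is, for each $2$-edge-coloring of $G$ there is one of the two colors such that every $d$-degenerate graph on $k$ vertices with chromatic number at most $\chi$ occurs as an induced subgraph of $G$ all of whose edges have that color).
   Context: All graphs are finite and simple; $\log$ is to base $2$. For subsets $A,B$ of vertices of a graph, the edge density $d(A,B)$ is the fraction of pairs $(x,y)\in A\times B$ that are edges, $d(A,B)=\frac{e(A,B)}{|A||B|}$. A graph $G=(V,E)$ is $(p,\lambda)$-pseudo-random if $|d(A,B)-p| \leq \frac{\lambda}{\sqrt{|A||B|}}$ for all (nonempty) subsets $A,B \subset V$. A graph is $d$-degenerate if every subgraph of it has a vertex of degree at most $d$. An induced monochromatic copy of $H$ in an edge-colored graph $G$ is an induced subgraph of $G$ isomorphic to $H$ all of whose edges have the same color. *)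

(* Defs.v *)
From mathcomp Require Import all_boot all_order all_algebra.
From mathcomp Require Import reals exp.

Set Implicit Arguments.
Unset Strict Implicit.
Unset Printing Implicit Defensive.

Import Order.TTheory GRing.Theory Num.Theory.

Record sgraph := SGraph {
  vertex :> finType;
  edge : rel vertex;
  edge_sym : symmetric edge;
  edge_irrefl : irreflexive edge }.

Section Graphs.
Implicit Types G H : sgraph.

(* The subgraph of G with vertex set S and edge relation F. *)
Definition is_subgraph G (S : {set G}) (F : rel G) : Prop :=
  symmetric F /\ forall x y, F x y -> [/\ x \in S, y \in S & edge x y].

(* Only nonempty subgraphs are considered, as the empty one has no vertex. *)
Definition degenerate (d : nat) G : Prop :=
  forall (S : {set G}) (F : rel G), is_subgraph S F -> S != set0 ->
    exists2 v, v \in S & #|[set u | F v u]| <= d.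

Definition colorable G (m : nat) : bool :=
  [exists f : {ffun G -> 'I_m}, forall x, forall y, edge x y ==> (f x != f y)].

Lemma colorable_ex G : exists m, colorable G m.
Proof.
exists #|G|; apply/existsP; exists [ffun x => enum_rank x].
apply/forallP => x; apply/forallP => y; apply/implyP => xy.
rewrite !ffunE (inj_eq enum_rank_inj); apply: contraTneq xy => ->.
by rewrite edge_irrefl.
Qed.

Definition chromatic_number G : nat := ex_minn (colorable_ex G).

Definition isomorphic G H : Prop :=
  exists2 f : G -> H, bijective f & forall x y, edge (f x) (f y) = edge x y.

Definition induced_edge G (S : {set G}) : rel {x | x \in S} :=
  fun x y => edge (val x) (val y).

Lemma induced_sym G (S : {set G}) : symmetric (@induced_edge G S).
Proof. by move=> x y; apply: edge_sym. Qed.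

Lemma induced_irrefl G (S : {set G}) : irreflexive (@induced_edge G S).
Proof. by move=> x; apply: edge_irrefl. Qed.

Definition induced G (S : {set G}) : sgraph :=
  SGraph (@induced_sym G S) (@induced_irrefl G S).

(* A 2-coloring of the edges of G is a map c from vertex sets to bool, where
   c [set x; y] is the color of the edge xy; its values at sets that are not
   edges are never used. *)
Definition induced_copy_in_color G (c : {set G} -> bool) (b : bool) H : Prop :=
  exists2 S : {set G}, isomorphic (induced S) H &
    forall x y, x \in S -> y \in S -> edge x y -> c [set x; y] = b.

Definition induced_mono_copy G (c : {set G} -> bool) H : Prop :=
  exists b, induced_copy_in_color c b H.

End Graphs.

Local Open Scope ring_scope.

Section PseudoRandom.
Variables (R : realType) (G : sgraph).

(* A and B may overlap: an edge inside their intersection counts twice. *)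
Definition density (A B : {set G}) : R :=
  #|[set xy in setX A B | edge xy.1 xy.2]|%:R / (#|A|%:R * #|B|%:R).

Definition pseudo_random (p lambda : R) : Prop :=
  forall A B : {set G}, A != set0 -> B != set0 ->
    `|density A B - p| <= lambda / Num.sqrt (#|A|%:R * #|B|%:R).

End PseudoRandom.

Definition log2 (R : realType) (x : R) : R := ln x / ln 2.

(* Main.v *)
Require Import Defs.
From mathcomp Require Import all_boot all_order all_algebra.
From mathcomp Require Import unstable boolp interval_inference convex.
From mathcomp Require Import reals exp ring lra.
Set Implicit Arguments.
Unset Strict Implicit.
Unset Printing Implicit Defensive.
Import Order.TTheory GRing.Theory Num.Theory.
Local Open Scope ring_scope.

(** Write b = p/(10k) and q = b^d 2^(-pk), and call the two colors red and
    blue. Both colors are handled by a greedy embedding: the vertices of H are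
    placed in an order in which each has at most d earlier neighbors, and every
    vertex still to be placed keeps the set of its candidates, the vertices of
    G that are related in the right way to all those already chosen.

    Suppose that some admissible graph H0 has no red copy. Run the embedding of
    H0 in red inside a large set U. By pseudo-randomness almost all choices
    leave a proportion 1 - 7p/6 of any candidate set outside a neighborhood, so
    the process can only stop because many candidates x have red degree at most
    b^4 |Y| into the candidate set Y of a later neighbor. Candidate sets keep
    at least a proportion b^(4d) (1 - 7p/6)^k >= q^4 of U. Hence every large U
    contains X and Y of size at least 2 q^5 |U| with few red edges between them
    (embedding_or_sparse_pair). Splitting X and Y again in the same way, h
    times in all, gives 2^h sets of size at least q^(5h) n whose pairwise red
    densities are at most 2^h b^4 (sparse_family). Here h is log chi rounded
    up, after chi has been lowered to k if it is larger, so 2^h <= 2k.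

    Now let H be any admissible graph, send its color classes to different sets
    of that family, and embed H in blue. The red density between two sets is
    small, but a candidate set is a far smaller part of its set than this
    density, so red edges might concentrate between the candidate sets. A good
    choice of vertices avoids this. Let the potential be the sum of the red
    densities between the candidate sets of adjacent vertices that are still to
    be placed. For a candidate x taken at random, a pair y, z survives with a
    probability close to the product of the two densities, for all but very few
    pairs, because G is pseudo-random (codegree_pairs). So on average the
    potential grows by a factor 1 + O(1/k) only, and some x does no worse than
    the average (potential_step). The potential starts at most 2 k^3 b^4, at
    most doubles, and so remains below b/10. It also counts the red edges from
    x to the candidates of later neighbors; these are therefore so few that
    deleting their ends is harmless.

    Both embeddings need lambda <= b^6 c when all candidate sets have at least
    c elements. As c is at least q^4 q^(5h) n and q <= b, it suffices that
    lambda <= q^(5h+10) n, and 5h + 10 <= 20 log chi because 2^(h-1) < chi and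
    2 <= chi. *)

(** * Averaging over finite sets *)

Lemma ler_sum_subpred (R : numDomainType) (I : finType) (P Q : pred I)
    (f : I -> R) :
  subpred P Q -> (forall i, 0 <= f i) ->
  \sum_(i | P i) f i <= \sum_(i | Q i) f i.
Proof.
move=> PQ f_ge0; rewrite big_mkcond [leRHS]big_mkcond; apply: ler_sum => i _.
by case: ifP => [/PQ->//|_]; case: ifP.
Qed.

Lemma pigeonhole_cover (I T : finType) (i0 : I) (A : {set T})
    (F : I -> {set T}) :
  (forall x, x \in A -> exists i, x \in F i) ->
  exists i, (#|A| <= #|I| * #|F i|)%N.
Proof.
move=> coverA; pose i := [arg max_(i > i0) #|F i|]; exists i.
have maxF j : (#|F j| <= #|F i|)%N.
  by rewrite /i; case: arg_maxnP => // i' _; apply.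
have AF : A \subset \bigcup_i F i.
  by apply/subsetP=> x /coverA[j xF]; apply/bigcupP; exists j.
apply: leq_trans (subset_leq_card AF) _; rewrite -sum_nat_const.
elim/big_rec2: _ => [|j n B _ cardB]; first by rewrite cards0.
apply: leq_trans (leq_add (maxF j) cardB).
by rewrite cardsU leq_subr.
Qed.

(** First moment method with a set Z of forbidden points, a proportion theta of
    A at most. *)
Lemma exists_small_value (R : realFieldType) (T : finType) (A Z : {set T})
    (F : T -> R) (S B theta : R) :
  (forall x, x \in A -> 0 <= F x) -> \sum_(x in A) F x <= S -> 0 <= B ->
  #|Z|%:R <= theta * #|A|%:R -> S < B * ((1 - theta) * #|A|%:R) ->
  exists x, [/\ x \in A, x \notin Z & F x <= B].
Proof.
move=> F_ge0 FS B_ge0 cardZ SB.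
have [/existsP[x /and3P[xA xZ FB]]|noneB] :=
    boolP [exists x, [&& x \in A, x \notin Z & F x <= B]]; first by exists x.
exfalso; have : B * ((1 - theta) * #|A|%:R) <= S.
  apply: le_trans FS; apply: le_trans (_ : B * #|A :\: Z|%:R <= _).
    apply: ler_wpM2l => //.
    have : #|A|%:R <= #|Z|%:R + #|A :\: Z|%:R :> R.
      rewrite -natrD ler_nat -(cardsID Z A) leq_add2r subset_leq_card //.
      by rewrite subsetIr.
    by move: cardZ; lra.
  rewrite mulr_natr -sumr_const [leRHS](big_setID Z) /= -[leLHS]add0r lerD //.
    by apply: sumr_ge0 => x; rewrite inE => /andP[/F_ge0].
  apply: ler_sum => x; rewrite inE => /andP[xZ xA]; rewrite leNgt; apply/negP.
  move=> /ltW FB; move/negP: noneB; apply; apply/existsP; exists x.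
  by rewrite xA xZ.
by rewrite leNgt SB.
Qed.

(** * Degrees and pairs in a pseudo-random graph *)

Section Counting.
Variable T : finType.
Implicit Types (r : rel T) (A B : {set T}).

Definition deg r B x : nat := #|[set y in B | r x y]|.

Definition pairs r A B : nat := \sum_(x in A) deg r B x.

Lemma degE r B x : deg r B x = (\sum_(y in B) r x y)%N.
Proof.
rewrite /deg -sum1dep_card big_mkcondr /=.
by apply: eq_bigr => y _; case: (r x y).
Qed.

Lemma pairsC r A B : symmetric r -> pairs r A B = pairs r B A.
Proof.
move=> r_sym; rewrite /pairs; under eq_bigr do rewrite degE.
rewrite exchange_big /=; apply: eq_bigr => y _; rewrite degE.
by apply: eq_bigr => x _; rewrite r_sym.
Qed.

Lemma deg_subset r A B x : A \subset B -> (deg r A x <= deg r B x)%N.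
Proof.
move=> /subsetP AB; apply: subset_leq_card; apply/subsetP=> y.
by rewrite !inE => /andP[/AB -> ->].
Qed.

Lemma pairs_subset r A A' B B' : A \subset A' -> B \subset B' ->
  (pairs r A B <= pairs r A' B')%N.
Proof.
move=> AA' BB'; apply: (@leq_trans (pairs r A B')).
  by apply: leq_sum => x _; apply: deg_subset.
by rewrite /pairs [leqRHS](big_setID A) /= (setIidPr AA') leq_addr.
Qed.

End Counting.

Section PseudoRandomCounts.
Variables (R : realType) (G : sgraph) (p lambda : R).
Hypothesis prG : pseudo_random G p lambda.
Implicit Types (sg : bool) (A B M : {set G}).

(** With [sg = false] this is non-adjacency and includes the diagonal, which
    makes the two relations complementary. *)
Definition adj sg : rel G := fun x y => edge x y == sg.

Definition adj_density sg : R := if sg then p else 1 - p.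

Lemma adj_sym sg : symmetric (adj sg).
Proof. by move=> x y; rewrite /adj edge_sym. Qed.

Lemma deg_adjN sg B x : (deg (adj (~~ sg)) B x + deg (adj sg) B x = #|B|)%N.
Proof.
rewrite !degE -big_split /= -sum1_card; apply: eq_bigr => y _.
by rewrite /adj; case: edge; case: sg.
Qed.

Lemma card_edge_setX A B :
  #|[set xy in setX A B | edge xy.1 xy.2]| = pairs (adj true) A B.
Proof.
rewrite /pairs; under eq_bigr do rewrite /deg -sum1dep_card.
rewrite pair_big_dep /= -sum1_card; apply: eq_bigl => -[x y] /=.
by rewrite !inE /= /adj eqb_id andbA.
Qed.

(** The squared form of the definition has neither square roots nor divisions,
    makes sense for empty sets, and also holds for non-adjacency, since both
    sides are unchanged when edges and non-edges (loops included) are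
    exchanged. *)
Lemma pseudo_random_dev sg A B :
  ((pairs (adj sg) A B)%:R - adj_density sg * (#|A|%:R * #|B|%:R)) ^+ 2
    <= lambda ^+ 2 * (#|A|%:R * #|B|%:R).
Proof.
have dev_edge : ((pairs (adj true) A B)%:R - p * (#|A|%:R * #|B|%:R)) ^+ 2
    <= lambda ^+ 2 * (#|A|%:R * #|B|%:R).
  have [->|A0] := eqVneq A set0.
    by rewrite /pairs big_set0 cards0 !mul0r !mulr0 subr0 expr0n.
  have [->|B0] := eqVneq B set0.
    by rewrite pairsC ?/pairs ?big_set0 ?cards0 ?mulr0 ?subr0 ?expr0n //;
       apply: adj_sym.
  have a_gt0 : 0 < #|A|%:R * #|B|%:R :> R.
    by rewrite mulr_gt0 // ltr0n card_gt0.
  have := prG A0 B0; rewrite /density card_edge_setX.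
  move: (#|A|%:R * #|B|%:R) (pairs _ _ _)%:R a_gt0 => a e a_gt0 dev.
  have s_gt0 : 0 < Num.sqrt a by rewrite sqrtr_gt0.
  have aE : a = Num.sqrt a ^+ 2 by rewrite sqr_sqrtr // ltW.
  have -> : e - p * a = (e / a - p) * a by field; rewrite gt_eqF.
  have -> : lambda ^+ 2 * a = (lambda / Num.sqrt a) ^+ 2 * a ^+ 2.
    by rewrite expr_div_n -aE; field; rewrite gt_eqF.
  rewrite exprMn ler_pM2r ?exprn_gt0 //.
  by rewrite -[leLHS]real_normK ?num_real // lerXn2r // nnegrE
    ?(le_trans _ dev).
case: sg => //=.
have -> : (pairs (adj false) A B)%:R
    = #|A|%:R * #|B|%:R - (pairs (adj true) A B)%:R :> R.
  apply/eqP; rewrite eq_sym subr_eq -natrM -natrD eqr_nat.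
  rewrite /pairs -big_split /= -sum_nat_const; apply/eqP.
  by apply: eq_bigr => x _; rewrite (deg_adjN true).
by apply: le_trans dev_edge; rewrite le_eqVlt; apply/orP; left; apply/eqP; ring.
Qed.

(** All of A deviates in the same direction, so the deviations add up in the
    number of pairs between A and B, and pseudo-randomness bounds A. *)
Lemma few_large_degree sg A B (e : R) : 0 <= e ->
  (forall x, x \in A ->
     adj_density sg * #|B|%:R + e <= (deg (adj sg) B x)%:R) ->
  e ^+ 2 * #|A|%:R <= lambda ^+ 2 * #|B|%:R.
Proof.
move=> e_ge0 degA.
have [->|A0] := eqVneq A set0.
  by rewrite cards0 mulr0 mulr_ge0 ?sqr_ge0.
have A_gt0 : 0 < #|A|%:R :> R by rewrite ltr0n card_gt0.
rewrite -(ler_pM2r A_gt0); apply: le_trans (le_trans (pseudo_random_dev sg A B) _).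
  rewrite -mulrA -expr2 -exprMn lerXn2r ?nnegrE ?mulr_ge0 //.
    rewrite subr_ge0 /pairs natr_sum mulrCA mulr_natl -sumr_const.
    by apply: ler_sum => x /degA; apply: le_trans; rewrite lerDl.
  rewrite /pairs natr_sum.
  have : \sum_(x in A) (adj_density sg * #|B|%:R + e)
      <= \sum_(x in A) (deg (adj sg) B x)%:R :> R by apply: ler_sum.
  by rewrite sumr_const -mulr_natr; lra.
by rewrite mulrCA mulrC -!mulrA.
Qed.

Lemma few_small_degree sg A B (e : R) : 0 <= e ->
  (forall x, x \in A ->
     (deg (adj sg) B x)%:R <= adj_density sg * #|B|%:R - e) ->
  e ^+ 2 * #|A|%:R <= lambda ^+ 2 * #|B|%:R.
Proof.
move=> e_ge0 degA; apply: (@few_large_degree (~~ sg)) => // x /degA.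
have /(congr1 (fun m => m%:R : R)) := deg_adjN sg B x.
by rewrite natrD /adj_density; case: (sg) => /= <-; lra.
Qed.

End PseudoRandomCounts.

(** * Building an embedding one vertex at a time *)

(** Remove a vertex of degree at most d, rank the remaining vertices, and put
    the removed vertex last. *)
Lemma degenerate_rank (d : nat) (H : sgraph) : degenerate d H ->
  exists r : H -> nat, [/\ injective r, forall v, (r v < #|H|)%N &
    forall v, (#|[set u | edge v u & (r u < r v)%N]| <= d)%N].
Proof.
move=> degH.
suff rank_on (m : nat) (S : {set H}) : #|S| = m ->
    exists r : H -> nat, {in S &, injective r} /\
      forall v, v \in S -> (r v < m)%N /\
        (#|[set u in S | edge v u & (r u < r v)%N]| <= d)%N.
  have [r [r_inj rP]] := rank_on _ [set: H] (erefl _).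
  exists r; split=> [u v|v|v]; first by apply: r_inj; rewrite inE.
    by have [] := rP v (in_setT v); rewrite cardsT.
  have [_] := rP v (in_setT v); congr (_ <= _)%N; apply: eq_card => u.
  by rewrite !inE.
elim: m S => [|m IHm] S cardS.
  exists (fun=> 0%N); split=> [u v|v]; by rewrite (cards0_eq cardS) inE.
pose F := [rel x y : H | [&& x \in S, y \in S & edge x y]].
have subF : is_subgraph S F.
  split=> [x y|x y /and3P[]//]; rewrite /= edge_sym.
  by case: (x \in S); case: (y \in S).
have S0 : S != set0 by rewrite -card_gt0 cardS.
have [v vS degv] := degH S F subF S0.
have [|r [r_inj rP]] := IHm (S :\ v).
  by move: cardS; rewrite (cardsD1 v) vS add1n => -[].
pose r' u := if u == v then m else r u.
have r'_lt u : u \in S -> u != v -> r' u = r u /\ (r u < m)%N.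
  move=> uS uv; rewrite /r' (negbTE uv); split=> //.
  by have [] := rP u; rewrite ?inE ?uv.
exists r'; split=> [x y xS yS|x xS].
  have [->|xv] := eqVneq x v; have [->|yv] := eqVneq y v => //.
  - have [-> ry] := r'_lt y yS yv; rewrite /r' eqxx => mE.
    by rewrite mE ltnn in ry.
  - have [-> rx] := r'_lt x xS xv; rewrite /r' eqxx => mE.
    by rewrite mE ltnn in rx.
  have [-> _] := r'_lt x xS xv; have [-> _] := r'_lt y yS yv.
  by apply: r_inj; rewrite !inE ?xv ?yv.
have [->|xv] := eqVneq x v.
  split; first by rewrite /r' eqxx.
  apply: leq_trans degv; apply: subset_leq_card; apply/subsetP=> u.
  by rewrite !inE /= vS => /and3P[-> -> _].
have [r'x rx] := r'_lt x xS xv; split; first by rewrite r'x ltnS ltnW.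
have [|_ degx] := rP x; first by rewrite !inE xv.
apply: leq_trans degx; apply: subset_leq_card; apply/subsetP=> u.
rewrite !inE r'x => /and3P[uS -> ru] /=; rewrite uS.
have [uv|uv] := eqVneq u v.
  by move: ru; rewrite /r' uv eqxx ltnNge ltnW.
by move: ru; have [-> _] := r'_lt u uS uv.
Qed.

(** The invariant is only asked of the candidate sets: whatever has been chosen
    so far is recorded in them. The vertices of rank at least t are placed by
    downward induction on t, so that the map is built from the last vertex
    backwards while the candidate sets shrink forwards. *)
Lemma greedy_choice (T V : finType) (x0 : V) (rel_ : T -> T -> rel V)
    (r : T -> nat) (Inv : nat -> (T -> {set V}) -> Prop) :
  injective r -> (forall i, (r i < #|T|)%N) ->
  (forall i j x y, rel_ i j x y = rel_ j i y x) ->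
  (forall m C, Inv (r m) C -> exists2 x, x \in C m &
     Inv (r m).+1 (fun j => [set y in C j | rel_ m j x y])) ->
  forall C, Inv 0%N C -> exists f : T -> V,
    forall i j, i != j -> rel_ i j (f i) (f j).
Proof.
move=> r_inj r_lt rel_C step.
have r_onto t : (t < #|T|)%N -> exists m, r m = t.
  move=> tT; pose ro i := Ordinal (r_lt i).
  have ro_inj : injective ro by move=> i j [] /r_inj.
  have [|g _ gK] := inj_card_bij ro_inj; first by rewrite card_ord.
  by exists (g (Ordinal tT)); have /(congr1 val) := gK (Ordinal tT).
suff from_t n t C : (t + n)%N = #|T| -> Inv t C -> exists f : T -> V,
    (forall i, (t <= r i)%N -> f i \in C i) /\
    forall i j, (t <= r i)%N -> (t <= r j)%N -> i != j ->
      rel_ i j (f i) (f j).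
  move=> C /(from_t #|T| 0%N C (erefl _)) [f [_ fP]].
  by exists f => i j; apply: fP.
elim: n t C => [|n IHn] t C.
  rewrite addn0 => tT _; exists (fun=> x0).
  by split=> [i|i j]; rewrite tT leqNgt r_lt.
move=> tn; have [m rm] : exists m, r m = t.
  by apply: r_onto; rewrite -tn -[X in (X < _)%N]addn0 ltn_add2l.
subst t.
move=> /step [x xC /IHn]; rewrite addSnnS => /(_ tn) [f [fC fP]].
have later i : i != m -> (r m <= r i)%N -> (r m < r i)%N.
  by move=> im rmi; rewrite ltn_neqAle rmi andbT eq_sym (inj_eq r_inj).
exists (fun i => if i == m then x else f i); split=> [i rmi|i j rmi rmj ij].
  have [->//|im] := eqVneq i m.
  by have := fC i (later i im rmi); rewrite inE => /andP[].
have [im|im] := eqVneq i m; have [jm|jm] := eqVneq j m.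
- by rewrite im jm eqxx in ij.
- by have := fC j (later j jm rmj); rewrite inE im => /andP[].
- by have := fC i (later i im rmi); rewrite inE jm rel_C => /andP[].
- by apply: fP => //; apply: later.
Qed.

(** The requirement on the images x and y of two distinct vertices i and j in an
    induced copy of H with all edges in e. *)
Definition fits (G H : sgraph) (e : rel G) (i j : H) : rel G :=
  fun x y => (x != y) && (if edge i j then e x y else ~~ edge x y).

Lemma fits_sym (G H : sgraph) (e : rel G) : symmetric e ->
  forall (i j : H) x y, fits e i j x y = fits e j i y x.
Proof.
by move=> e_sym i j x y; rewrite /fits eq_sym e_sym ![edge _ x]edge_sym edge_sym.
Qed.

Lemma induced_copy_of_map (G H : sgraph) (c : {set G} -> bool) (b : bool)
    (f : H -> G) :
  (forall i j, i != j -> f i != f j) ->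
  (forall i j, edge (f i) (f j) = edge i j) ->
  (forall i j, edge i j -> c [set f i; f j] = b) ->
  induced_copy_in_color c b H.
Proof.
move=> f_neq fE fc.
have f_inj : injective f by move=> i j; apply: contra_eq; apply: f_neq.
exists (f @: [set: H]); last first.
  by move=> _ _ /imsetP[i _ ->] /imsetP[j _ ->]; rewrite fE; apply: fc.
pose F (i : H) : {x | x \in f @: [set: H]} := exist _ (f i) (imset_f f (in_setT i)).
have F_inj : injective F by move=> i j [] /f_inj.
have [|g FK gK] := inj_card_bij F_inj.
  by rewrite card_sig cardE -cardE (card_imset _ f_inj) cardsT.
exists g; first by exists F.
move=> x y; rewrite -[x in RHS]gK -[y in RHS]gK.
by rewrite /= /induced_edge /= fE.
Qed.

Definition color_class (G : sgraph) (c : {set G} -> bool) (b : bool) : rel G :=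
  fun x y => edge x y && (c [set x; y] == b).

Lemma color_class_sym (G : sgraph) c b : symmetric (@color_class G c b).
Proof. by move=> x y; rewrite /color_class edge_sym setUC. Qed.

Lemma induced_copy_of_fits (G H : sgraph) (c : {set G} -> bool) (b : bool)
    (e : rel G) (f : H -> G) : subrel e (color_class c b) ->
  (forall i j, i != j -> fits e i j (f i) (f j)) -> induced_copy_in_color c b H.
Proof.
move=> e_c fitsf; apply: (@induced_copy_of_map _ _ _ _ f).
- by move=> i j /fitsf/andP[].
- move=> i j; have [->|/fitsf/andP[_]] := eqVneq i j; first by rewrite !edge_irrefl.
  by case: ifP => [ij /e_c/andP[]|_ /negbTE].
- move=> i j ij; have /fitsf/andP[_] : i != j.
    by apply: contraTneq ij => ->; rewrite edge_irrefl.
  by rewrite ij => /e_c/andP[_ /eqP].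
Qed.

Section CandidateSizes.
Variables (R : realType) (G H : sgraph) (r : H -> nat) (d : nat).
Hypothesis r_inj : injective r.
Hypothesis r_lt : forall v, (r v < #|H|)%N.
Hypothesis r_deg : forall v, (#|[set u | edge v u & (r u < r v)%N]| <= d)%N.
Variables (alpha beta w : R).
Hypotheses (alpha_gt0 : 0 < alpha) (alpha_le1 : alpha <= 1).
Hypotheses (beta_gt0 : 0 < beta) (beta_le1 : beta <= 1) (w_ge0 : 0 <= w).
Implicit Types (C : H -> {set G}).

Definition earlier t (v : H) : nat := #|[set u | edge v u & (r u < t)%N]|.

(** Placing a vertex multiplies a candidate set by alpha or more if it belongs
    to a neighbor and by beta or more otherwise. Using beta^t also at the steps
    that placed a neighbor avoids a subtraction in the exponent. *)
Definition large_candidates t C : Prop := forall j, (t <= r j)%N ->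
  alpha ^+ earlier t j * beta ^+ t * w <= #|C j|%:R.


Lemma large_candidates_ge t C j : large_candidates t C -> (t <= r j)%N ->
  alpha ^+ d * beta ^+ #|H| * w <= #|C j|%:R.
Proof.
move=> largeC tj; apply: le_trans (largeC j tj).
apply: ler_wpM2r => //; apply: ler_pM; rewrite ?exprn_ge0 ?(ltW alpha_gt0) //.
- by rewrite (ltW beta_gt0).
- rewrite ler_wiXn2l ?(ltW alpha_gt0) //; apply: leq_trans (r_deg j).
  apply: subset_leq_card; apply/subsetP=> u; rewrite !inE => /andP[-> ut].
  exact: leq_trans ut tj.
by rewrite ler_wiXn2l ?(ltW beta_gt0) // (leq_trans tj) // ltnW.
Qed.

Lemma large_candidates0 C : (forall j, w <= #|C j|%:R) -> large_candidates 0 C.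
Proof.
move=> wC j _; rewrite (_ : earlier 0 j = 0%N) ?expr0 ?mul1r //.
by apply/eqP; rewrite cards_eq0; apply/eqP/setP=> u; rewrite !inE andbF.
Qed.

Lemma large_candidatesS m C C' : large_candidates (r m) C ->
  (forall j, (r m < r j)%N ->
     (if edge m j then alpha else beta) * #|C j|%:R <= #|C' j|%:R) ->
  large_candidates (r m).+1 C'.
Proof.
move=> largeC shrink j mj; apply: le_trans (shrink j mj).
have earlierS : earlier (r m).+1 j = (edge m j + earlier (r m) j)%N.
  rewrite /earlier (cardsD1 m) !inE ltnSn andbT edge_sym; congr (_ + _)%N.
  apply: eq_card => u; rewrite !inE ltnS andbCA; congr (_ && _).
  have [->|um] := eqVneq u m; first by rewrite ltnn.
  by rewrite [RHS]ltn_neqAle (inj_eq r_inj) um.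
have sizeC := largeC j (ltnW mj).
have f_ge0 : 0 <= alpha ^+ earlier (r m) j * beta ^+ r m * w.
  by rewrite !mulr_ge0 ?exprn_ge0 // ltW.
rewrite earlierS exprS; case: edge; rewrite ?exprS ?expr0.
  apply: le_trans (_ : alpha * (alpha ^+ earlier (r m) j * beta ^+ r m * w) <= _);
    last by rewrite ler_wpM2l // ltW.
  rewrite (_ : _ * w =
    beta * (alpha * (alpha ^+ earlier (r m) j * beta ^+ r m * w))); last by ring.
  by rewrite ler_piMl // mulr_ge0 // ltW.
apply: le_trans (_ : beta * (alpha ^+ earlier (r m) j * beta ^+ r m * w) <= _);
  last by rewrite ler_wpM2l // ltW.
by rewrite add0n le_eqVlt; apply/orP; left; apply/eqP; ring.
Qed.

End CandidateSizes.

(** * Families of pairwise sparse sets *)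

Section SparseFamily.
Variables (R : realType) (T : finType) (r : rel T).
Hypothesis r_sym : symmetric r.
Implicit Types (A B U : {set T}) (s : seq {set T}).

Definition sparse (kappa : R) A B : bool :=
  (pairs r A B)%:R <= kappa * (#|A|%:R * #|B|%:R).

Lemma card_has_le (P : T -> {set T} -> bool) A s :
  (#|[set y in A | has (P y) s]| <= \sum_(B <- s) #|[set y in A | P y B]|)%N.
Proof.
elim: s => [|B s IHs]; first by rewrite big_nil leqn0 cards_eq0;
  apply/eqP/setP=> y; rewrite !inE andbF.
rewrite big_cons; apply: leq_trans (leq_add (leqnn _) IHs).
have -> : [set y in A | has (P y) (B :: s)]
    = [set y in A | P y B] :|: [set y in A | has (P y) s].
  by apply/setP=> y; rewrite !inE -andb_orr.
by rewrite cardsU leq_subr.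
Qed.

(** Split U into a sparse pair X, Y, find a family in X by induction, and delete
    the vertices of Y of degree more than 2^(h+1) e |A| into some member A of
    it. The average degree into A is at most e |A|, so A causes the loss of at
    most |Y| / 2^(h+1) vertices, and the 2^h members together of at most half
    of Y, whence the factor 2 in the hypothesis.
    Bounds on single degrees, unlike densities, are inherited by all subsets,
    so the family found by induction in the rest of Y is sparse to the first
    one. *)
Lemma sparse_family (gamma e M : R) : 0 < gamma -> gamma <= 1 -> 0 < e ->
  (forall U, M <= #|U|%:R -> exists X Y : {set T},
     [/\ X \subset U, Y \subset U, 2 * gamma * #|U|%:R <= #|X|%:R,
         2 * gamma * #|U|%:R <= #|Y|%:R &
         forall x, x \in X -> (deg r Y x)%:R <= e * #|Y|%:R]) ->
  forall h U, M <= gamma ^+ h * #|U|%:R -> exists s : seq {set T},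
    [/\ size s = (2 ^ h)%N,
        forall A, A \in s -> A \subset U /\ gamma ^+ h * #|U|%:R <= #|A|%:R &
        pairwise (sparse ((2 ^ h)%:R * e)) s].
Proof.
move=> g_gt0 g_le1 e_gt0 split_pair; elim=> [|h IHh] U MU.
  exists [:: U]; split=> // A; rewrite inE => /eqP->.
  by rewrite expr0 mul1r.
have gh_ge0 : 0 <= gamma ^+ h by rewrite exprn_ge0 ?ltW.
have ghU : gamma ^+ h.+1 * #|U|%:R = gamma ^+ h * (gamma * #|U|%:R).
  by rewrite exprSr mulrA.
have MU1 : M <= #|U|%:R.
  apply: le_trans MU _; rewrite -[leRHS]mul1r ler_wpM2r //.
  by rewrite exprn_ile1 // ltW.
have gU_ge0 : 0 <= gamma * #|U|%:R by rewrite mulr_ge0 // ltW.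
have [X [Y [XU YU cX cY degX]]] := split_pair U MU1.
have gUX : gamma * #|U|%:R <= #|X|%:R by lra.
have [|s [size_s sP pw_s]] := IHh X.
  by apply: le_trans MU _; rewrite ghU ler_wpM2l.
have sparse_sY A : A \in s -> (pairs r A Y)%:R <= e * (#|A|%:R * #|Y|%:R).
  move=> /sP[/subsetP AX _].
  have -> : e * (#|A|%:R * #|Y|%:R) = (e * #|Y|%:R) *+ #|A|.
    by rewrite -mulr_natr; ring.
  rewrite /pairs natr_sum -sumr_const.
  by apply: ler_sum => x /AX; apply: degX.
pose K : R := (2 ^ h.+1)%:R.
have K_gt0 : 0 < K by rewrite ltr0n expn_gt0.
pose dense y A := K * e * #|A|%:R < (deg r A y)%:R.
pose Y' := [set y in Y | ~~ has (dense y) s].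
have few_dense A : A \in s -> K * #|[set y in Y | dense y A]|%:R <= #|Y|%:R.
  move=> As; set Z := [set _ in _ | _].
  have [A0|A_gt0] := posnP #|A|.
    suff -> : Z = set0 by rewrite cards0 mulr0.
    apply/setP=> y; rewrite !inE /dense A0 mulr0 ltr0n (cards0_eq A0).
    by rewrite degE big_set0 andbF.
  have eA_gt0 : 0 < e * #|A|%:R by rewrite mulr_gt0 // ltr0n.
  rewrite -(ler_pM2r eA_gt0).
  have -> : #|Y|%:R * (e * #|A|%:R) = e * (#|A|%:R * #|Y|%:R) by ring.
  apply: le_trans (sparse_sY A As); rewrite pairsC //.
  have ZY : Z \subset Y by apply/subsetP=> y; rewrite inE => /andP[].
  apply: le_trans (_ : (pairs r Z A)%:R <= _); last first.
    by rewrite ler_nat pairs_subset.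
  have -> : K * #|Z|%:R * (e * #|A|%:R) = (K * e * #|A|%:R) *+ #|Z|.
    by rewrite -mulr_natr; ring.
  rewrite /pairs natr_sum -sumr_const; apply: ler_sum => y.
  by rewrite inE => /andP[_ /ltW].
have half_Y : #|Y|%:R <= 2 * #|Y'|%:R :> R.
  have cardY : #|Y|%:R = #|[set y in Y | has (dense y) s]|%:R + #|Y'|%:R :> R.
    rewrite -natrD; congr _%:R; rewrite -(cardsID [set y | has (dense y) s] Y).
    by congr (_ + _)%N; apply: eq_card => y; rewrite !inE // andbC.
  have : #|[set y in Y | has (dense y) s]|%:R
      <= \sum_(A <- s) #|[set y in Y | dense y A]|%:R :> R.
    by rewrite -natr_sum ler_nat card_has_le.
  have : K * (\sum_(A <- s) #|[set y in Y | dense y A]|%:R)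
      <= (2 ^ h)%:R * #|Y|%:R.
    have <- : \sum_(A <- s) #|Y|%:R = (2 ^ h)%:R * #|Y|%:R :> R.
      by rewrite big_const_seq count_predT iter_addr_0 size_s mulr_natl.
    rewrite mulr_sumr big_seq [leRHS]big_seq.
    by apply: ler_sum => A /few_dense.
  have -> : K = 2 * (2 ^ h)%:R by rewrite /K expnS natrM.
  have pow_gt0 : 0 < (2 ^ h)%:R :> R by rewrite ltr0n expn_gt0.
  by rewrite [2 * _]mulrC -mulrA ler_pM2l //; lra.
have [|s' [size_s' s'P pw_s']] := IHh Y'.
  by apply: le_trans MU _; rewrite ghU ler_wpM2l //; lra.
have mono A B : sparse ((2 ^ h)%:R * e) A B -> sparse (K * e) A B.
  move=> /le_trans; apply; apply: ler_wpM2r; first by rewrite mulr_ge0.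
  by apply: ler_wpM2r; [exact: ltW | rewrite ler_nat leq_exp2l].
exists (s ++ s'); split.
- by rewrite size_cat size_s size_s' addnn -mul2n expnS.
- move=> A; rewrite mem_cat ghU => /orP[/sP|/s'P] [AX cA].
    split; first exact: subset_trans AX XU.
    by apply: le_trans cA; rewrite ler_wpM2l.
  split.
    apply: subset_trans AX (subset_trans _ YU).
    by apply/subsetP=> y; rewrite inE => /andP[].
  by apply: le_trans cA; rewrite ler_wpM2l //; lra.
rewrite pairwise_cat (sub_pairwise mono pw_s) (sub_pairwise mono pw_s') !andbT.
apply/allrelP => A B As /s'P[/subsetP BY' _]; rewrite /sparse pairsC //.
have -> : K * e * (#|A|%:R * #|B|%:R) = (K * e * #|A|%:R) *+ #|B|.
  by rewrite -mulr_natr; ring.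
rewrite /pairs natr_sum -sumr_const; apply: ler_sum => y /BY'.
by rewrite inE => /andP[_ /hasPn /(_ A As)]; rewrite -leNgt.
Qed.

End SparseFamily.

(** * A copy in one color or a sparse pair *)

Section Embedding.
Variables (R : realType) (G H : sgraph) (p lambda : R) (d : nat) (r : H -> nat).
Hypothesis prG : pseudo_random G p lambda.
Hypotheses (p_gt0 : 0 < p) (p_le : p <= 3 / 4).
Hypothesis H_gt0 : (0 < #|H|)%N.
Hypothesis r_inj : injective r.
Hypothesis r_lt : forall v, (r v < #|H|)%N.
Hypothesis r_deg : forall v, (#|[set u | edge v u & (r u < r v)%N]| <= d)%N.
(* The starting sets have size at least w, hence all candidate sets have size at
   least c. *)
Variables (b w c : R).
Hypothesis pE : p = 10 * #|H|%:R * b.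
Local Notation K := (#|H|%:R : R).
Local Notation beta := (1 - 7 / 6 * p).
Hypotheses (c_gt0 : 0 < c) (c_le : c <= (b ^+ 4) ^+ d * beta ^+ #|H| * w).
Hypothesis lambda_le : lambda <= b ^+ 6 * c.
Implicit Types (C : H -> {set G}) (e : rel G).

Lemma cardH_ge1 : 1 <= K. Proof. by rewrite ler1n. Qed.

Lemma b_gt0 : 0 < b.
Proof. by have := p_gt0; rewrite pE pmulr_rgt0 // mulr_gt0 ?ltr0n. Qed.

Lemma b_le : b <= 3 / 40.
Proof.
have : 10 * b <= 10 * K * b.
  by rewrite ler_pM2r ?b_gt0 // ler_peMr // cardH_ge1.
by rewrite -pE; move: p_le; lra.
Qed.

Lemma b4_le1 : b ^+ 4 <= 1.
Proof. by rewrite exprn_ile1 // ?(ltW b_gt0) //; have := b_le; lra. Qed.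

Lemma beta_gt0 : 0 < beta. Proof. move: p_le; lra. Qed.

Lemma beta_le1 : beta <= 1. Proof. move: p_gt0; lra. Qed.

Lemma w_gt0 : 0 < w.
Proof.
have := lt_le_trans c_gt0 c_le; rewrite pmulr_rgt0 // mulr_gt0 ?exprn_gt0 //.
  exact: b_gt0.
exact: beta_gt0.
Qed.

(** A single vertex is a set of density 0, at distance p from p. *)
Lemma p_le_lambda (x : G) : p <= lambda.
Proof.
have x0 : [set x] != set0 by rewrite -card_gt0 cards1.
have := prG x0 x0; rewrite /density card_edge_setX /pairs big_set1 degE big_set1.
by rewrite /adj edge_irrefl !cards1 mul0r sub0r normrN mulr1 sqrtr1 divr1 gtr0_norm.
Qed.

Lemma lambda_sqr_le (x : G) : lambda ^+ 2 <= b ^+ 12 * c ^+ 2.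
Proof.
rewrite (_ : b ^+ 12 * c ^+ 2 = (b ^+ 6 * c) ^+ 2); last by ring.
have lambda_ge0 := le_trans (ltW p_gt0) (p_le_lambda x).
by rewrite lerXn2r // nnegrE // (le_trans lambda_ge0).
Qed.

(** Together with [p_le_lambda] the bound on lambda forces candidate sets to be
    so large that a single vertex, such as the one just chosen, is negligible. *)
Lemma bc_ge (x : G) : 10 <= b * c.
Proof.
have [[b0 b1] K1] := (b_gt0, b_le, cardH_ge1).
have : 10 * K * b <= b ^+ 5 * c * b.
  by rewrite -pE (le_trans (p_le_lambda x)) // (le_trans lambda_le) // le_eqVlt;
     apply/orP; left; apply/eqP; ring.
rewrite ler_pM2r // => Kle.
have : b ^+ 4 * (b * c) <= 1 * (b * c).
  by rewrite ler_wpM2r ?b4_le1 // mulr_ge0 // ltW.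
rewrite mul1r; apply: le_trans; apply: le_trans (le_trans Kle _); first by lra.
by rewrite le_eqVlt; apply/orP; left; apply/eqP; ring.
Qed.

Let large t C := large_candidates r (b ^+ 4) beta w t C.

Lemma large_ge t C j : large t C -> (t <= r j)%N -> c <= #|C j|%:R.
Proof.
move=> largeC tj; apply: le_trans c_le _.
apply: large_candidates_ge largeC tj => //; rewrite ?exprn_gt0 //.
- exact: b_gt0.
- exact: b4_le1.
- exact: beta_gt0.
- exact: beta_le1.
- exact: ltW w_gt0.
Qed.

Lemma large_step m C C' : large (r m) C ->
  (forall j, (r m < r j)%N ->
     (if edge m j then b ^+ 4 else beta) * #|C j|%:R <= #|C' j|%:R) ->
  large (r m).+1 C'.
Proof.
apply: large_candidatesS => //; rewrite ?exprn_gt0 //.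
- exact: b_gt0.
- exact: beta_gt0.
- exact: beta_le1.
- exact: ltW w_gt0.
Qed.

(** In the second case the chosen vertex is not adjacent to itself and has to be
    taken out of the candidates by hand. *)
Lemma card_fits e m j x C : subrel e (@edge G) ->
  #|[set y in C j | fits e m j x y]|
    = if edge m j then deg e (C j) x
      else (deg (adj false) (C j) x - (x \in C j))%N.
Proof.
move=> eE; rewrite /fits /deg; case: ifP => mj.
  apply: eq_card => y; rewrite !inE; congr (_ && _).
  have [<-|//] := eqVneq; apply/esym/negbTE/negP => /eE.
  by rewrite edge_irrefl.
rewrite [in RHS](cardsD1 x) inE /adj edge_irrefl eqxx andbT addKn.
apply: eq_card => y; rewrite !inE eqbF_neg eq_sym.
by rewrite andbCA.
Qed.

(** If the embedding is stuck at m, each candidate x shrinks the candidates of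
    some later j too much, and a proportion 1/|H| of them do so for the same j.
    They form X, and the candidates of j form Y. If j were not a neighbor of m,
    then X would have too many edges to Y for a pseudo-random graph. *)
Lemma embedding_or_sparse_pair e (U : {set G}) :
  symmetric e -> subrel e (@edge G) -> w <= #|U|%:R ->
  (exists f : H -> G, forall i j, i != j -> fits e i j (f i) (f j)) \/
  exists X Y : {set G}, [/\ X \subset U, Y \subset U, c <= K * #|X|%:R,
    c <= #|Y|%:R & forall x, x \in X -> (deg e Y x)%:R <= b ^+ 4 * #|Y|%:R].
Proof.
move=> e_sym eE wU.
have [U0|[x0 _]] := set_0Vmem U.
  by have := lt_le_trans w_gt0 wU; rewrite U0 cards0 ltxx.
have [|no_pair] := pselect (exists X Y : {set G}, [/\ X \subset U, Y \subset U,
    c <= K * #|X|%:R, c <= #|Y|%:R &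
    forall x, x \in X -> (deg e Y x)%:R <= b ^+ 4 * #|Y|%:R]); first by right.
left; pose Inv t C := large t C /\ forall j, C j \subset U.
apply: (@greedy_choice H G x0 (@fits G H e) r Inv _ _ _ _ (fun=> U)) => //.
- exact: fits_sym.
- move=> m C [largeC CU].
  pose C' x j := [set y in C j | fits e m j x y].
  pose shrinks x j := (if edge m j then b ^+ 4 else beta) * #|C j|%:R
                        <= #|C' x j|%:R.
  have [/existsP[x /andP[xC /forallP x_good]]|no_good] :=
      boolP [exists x in C m, forall j, (r m < r j)%N ==> shrinks x j].
    exists x => //; split.
      by apply: large_step largeC _ => j mj; have := x_good j; rewrite mj.
    move=> j; apply: subset_trans (CU j).
    by apply/subsetP=> y; rewrite inE => /andP[].
  exfalso; pose X j := [set x in C m | (r m < r j)%N && ~~ shrinks x j].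
  have [|j CX] := @pigeonhole_cover H G m (C m) X.
    move=> x xC; move: no_good; rewrite negb_exists_in.
    move=> /forall_inP/(_ x xC); rewrite negb_forall => /existsP[j].
    by rewrite negb_imply => jP; exists j; rewrite inE xC.
  have cX : c <= K * #|X j|%:R.
    apply: le_trans (large_ge largeC (leqnn _)) _.
    by rewrite -natrM ler_nat.
  have [X0|[x1]] := set_0Vmem (X j).
    by have := lt_le_trans c_gt0 cX; rewrite X0 cards0 mulr0 ltxx.
  rewrite inE => /and3P[_ mj _].
  have cC : c <= #|C j|%:R := large_ge largeC (ltnW mj).
  have XP x : x \in X j -> #|C' x j|%:R
      < (if edge m j then b ^+ 4 else beta) * #|C j|%:R.
    by rewrite inE -ltNge => /and3P[].
  move: XP; case: ifP => m_j XP.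
    apply: no_pair; exists (X j), (C j); split => //.
      by apply: subset_trans (CU m); apply/subsetP=> x; rewrite inE => /andP[].
    move=> x /XP/ltW; rewrite /C' (card_fits m j x C eE) m_j; exact.
  have degX x : x \in X j -> (deg (adj false) (C j) x)%:R
      <= adj_density p false * #|C j|%:R - p / 12 * #|C j|%:R.
    move=> /XP; rewrite /C' (card_fits m j x C eE) m_j.
    have : (deg (adj false) (C j) x)%:R
       <= (deg (adj false) (C j) x - (x \in C j))%:R + 1 :> R.
      rewrite -(natrD _ _ 1) ler_nat addn1.
      by case: (x \in C j); rewrite ?subn0 ?subn1 ?leqSpred.
    (* The vertex x itself costs 1 of the allowance p/6: half of it is left. *)
    have one_le : 12 <= p * #|C j|%:R.
      apply: le_trans (_ : p * c <= _); last by rewrite ler_wpM2l // ltW.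
      by rewrite pE; have := bc_ge x0; have := cardH_ge1; nra.
    by rewrite /adj_density /=; move: p_gt0 p_le; lra.
  have e_ge0 : 0 <= p / 12 * #|C j|%:R by rewrite mulr_ge0 // divr_ge0 // ltW.
  have := few_small_degree prG e_ge0 degX.
  have lam2 := lambda_sqr_le x0.
  have Cj_gt0 : 0 < #|C j|%:R :> R := lt_le_trans c_gt0 cC.
  have -> : (p / 12 * #|C j|%:R) ^+ 2 * #|X j|%:R
      = (25 / 36 * K * b ^+ 2) * (#|C j|%:R * (K * #|X j|%:R)) * #|C j|%:R :> R.
    by rewrite pE; field.
  rewrite ler_pM2r //; apply/negP; rewrite -ltNge; apply: le_lt_trans lam2 _.
  have [[b0 b1] K1] := (b_gt0, b_le, cardH_ge1).
  apply: lt_le_trans (_ : (25 / 36 * K * b ^+ 2) * (c * c) <= _); last first.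
    apply: ler_wpM2l; last by apply: ler_pM => //; apply: ltW.
    by rewrite mulr_ge0 ?exprn_ge0 ?(ltW b0) //; lra.
  rewrite -expr2 ltr_pM2r ?exprn_gt0 // (exprD b 2 10).
  rewrite [ltLHS]mulrC ltr_pM2r ?exprn_gt0 //.
  have : b ^+ 10 <= b by rewrite exprS ler_piMr ?exprn_ile1 ?(ltW b0) //; lra.
  by lra.
- by split => //; apply: large_candidates0 => j.
Qed.

(** * A copy between pairwise sparse sets *)

Definition nbhd sg (A : {set G}) x : {set G} := [set y in A | adj sg x y].

Lemma density_ge sg : 10 / 3 * b <= adj_density p sg.
Proof.
have Kb : b <= K * b by rewrite ler_peMl ?cardH_ge1 // ltW // b_gt0.
by rewrite /adj_density; case: sg; move: p_le b_le; rewrite pE; move: Kb b_gt0; lra.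
Qed.

(** The form in which [few_large_degree] is used, with deviation b/10 relative
    to a set of size u N. *)
Lemma exceptional_count_le (x : G) (u N t : R) :
  10 / 3 * b <= u -> c <= N -> 0 <= t ->
  (b / 10) ^+ 2 * (u * N) * t <= lambda ^+ 2 -> t <= 30 * b ^+ 9 * c.
Proof.
move=> u_ge cN t_ge0 /le_trans/(_ (lambda_sqr_le x)) t_le.
have b0 := b_gt0; have c0 := c_gt0.
have bc_gt0 : 0 < b ^+ 3 * c / 30 by rewrite divr_gt0 // mulr_gt0 // exprn_gt0.
rewrite -(ler_pM2l bc_gt0); apply: le_trans (le_trans t_le _); last first.
  by rewrite le_eqVlt; apply/orP; left; apply/eqP; field.
have -> : b ^+ 3 * c / 30 * t = (b / 10) ^+ 2 * (10 / 3 * b * c) * t by field.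
apply: ler_wpM2r => //; apply: ler_wpM2l; first exact: sqr_ge0.
by apply: ler_pM => //; lra.
Qed.

Section SparseParts.
Variable red : rel G.
Hypothesis red_sym : symmetric red.

(** Exchanging the sums counts each red pair (y, z) with the number of x in M
    that keep both y and z. That number exceeds the product of the two slightly
    increased densities only if y has exceptional degree into M, or if z has
    exceptional degree into the set of x in M that keep y. Both kinds of
    exceptions are rare, and they make up the second summand. *)
Lemma codegree_pairs sg1 sg2 (M A B : {set G}) :
  c <= #|M|%:R -> c <= #|A|%:R -> c <= #|B|%:R ->
  \sum_(x in M) (pairs red (nbhd sg1 A x) (nbhd sg2 B x))%:R <=
  #|M|%:R * ((adj_density p sg1 + b / 10) * (adj_density p sg2 + b / 10)
               * (pairs red A B)%:R + 60 * b ^+ 9 * (#|A|%:R * #|B|%:R)).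
Proof.
move=> cM cA cB; set u1 := adj_density p sg1 + _; set u2 := adj_density p sg2 + _.
have [[b0 b1] K1] := (b_gt0, b_le, cardH_ge1).
have M_gt0 := lt_le_trans c_gt0 cM.
have [x0 _] : exists x, x \in M.
  by apply/set0Pn; rewrite -card_gt0 -(ltr0n R).
have lam2 := lambda_sqr_le x0.
have u1_ge : 10 / 3 * b <= u1 by have := density_ge sg1; rewrite /u1; lra.
have u2_ge : 10 / 3 * b <= u2 by have := density_ge sg2; rewrite /u2; lra.
have u1_gt0 : 0 < u1 by lra.
have u2_gt0 : 0 < u2 by lra.
have pi2_ge0 : 0 <= adj_density p sg2 by have := density_ge sg2; lra.
have b9_ge0 : 0 <= 30 * b ^+ 9 by rewrite mulr_ge0 // exprn_ge0 // ltW.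
pose codeg y z : nat := #|[set x in M | adj sg1 x y && adj sg2 x z]|.
have -> : \sum_(x in M) (pairs red (nbhd sg1 A x) (nbhd sg2 B x))%:R
    = \sum_(y in A) \sum_(z in B) (red y z * codeg y z)%:R :> R.
  rewrite -natr_sum; under [RHS]eq_bigr do rewrite -natr_sum.
  rewrite -natr_sum; congr _%:R.
  transitivity (\sum_(x in M) \sum_(y in A) \sum_(z in B)
      (red y z * (adj sg1 x y && adj sg2 x z)))%N.
    apply: eq_bigr => x _; rewrite /pairs /nbhd.
    rewrite [LHS](eq_bigl (fun y => (y \in A) && adj sg1 x y)); last first.
      by move=> y; rewrite inE.
    rewrite big_mkcondr; apply: eq_bigr => y _; case: ifP => xy /=; last first.
      by rewrite big1 // => z _; rewrite muln0.
    rewrite degE (eq_bigl (fun z => (z \in B) && adj sg2 x z)); last first.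
      by move=> z; rewrite inE.
    rewrite big_mkcondr; apply: eq_bigr => z _.
    by case: adj; rewrite ?muln1 ?muln0.
  rewrite exchange_big; apply: eq_bigr => y _.
  rewrite exchange_big; apply: eq_bigr => z _ /=.
  rewrite -big_distrr /=; congr (_ * _)%N.
  rewrite /codeg -sum1dep_card big_mkcondr /=.
  by apply: eq_bigr => x _; case: (_ && _).
(* Y holds the exceptional first coordinates. *)
pose Y := [set y in A | u1 * #|M|%:R < (deg (adj sg1) M y)%:R].
have cardY : #|Y|%:R <= 30 * b ^+ 9 * #|A|%:R :> R.
  have degY y : y \in Y -> adj_density p sg1 * #|M|%:R + b / 10 * #|M|%:R
      <= (deg (adj sg1) M y)%:R.
    by rewrite inE -mulrDl => /andP[_ /ltW].
  have e_ge0 : 0 <= b / 10 * #|M|%:R by rewrite mulr_ge0 // divr_ge0 // ltW.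
  have := few_large_degree prG e_ge0 degY.
  have -> : (b / 10 * #|M|%:R) ^+ 2 * #|Y|%:R
      = (b / 10) ^+ 2 * (1 * #|M|%:R) * #|Y|%:R * #|M|%:R :> R by ring.
  rewrite ler_pM2r // => /(exceptional_count_le x0 _ cM (ler0n _ _)).
  by move=> /(_ _)/le_trans; apply; [lra | rewrite ler_wpM2l].
(* For y outside Y, few second coordinates are exceptional relative to y. *)
have cardZ y : y \in A -> y \notin Y ->
    #|[set z in B | u1 * u2 * #|M|%:R < (codeg y z)%:R]|%:R
      <= 30 * b ^+ 9 * #|B|%:R :> R.
  move=> yA; rewrite inE yA /= -leNgt => degy; set Z := [set _ in _ | _].
  pose D := [set x in M | adj sg1 x y].
  have cardD : #|D|%:R <= u1 * #|M|%:R.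
    apply: le_trans degy; rewrite ler_nat; apply: subset_leq_card.
    by apply/subsetP=> x; rewrite !inE adj_sym.
  have degZ z : z \in Z -> adj_density p sg2 * #|D|%:R + b / 10 * (u1 * #|M|%:R)
      <= (deg (adj sg2) D z)%:R.
    rewrite inE => /andP[_ /ltW].
    have -> : codeg y z = deg (adj sg2) D z.
      by apply: eq_card => x; rewrite !inE (adj_sym sg2 z) andbA.
    apply: le_trans; have -> : u1 * u2 * #|M|%:R
        = adj_density p sg2 * (u1 * #|M|%:R) + b / 10 * (u1 * #|M|%:R).
      by rewrite -mulrDl -/u2; ring.
    by rewrite lerD2r ler_wpM2l.
  have e_ge0 : 0 <= b / 10 * (u1 * #|M|%:R).
    by rewrite mulr_ge0 ?divr_ge0 ?mulr_ge0 // ltW.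
  have u1M_gt0 : 0 < u1 * #|M|%:R by rewrite mulr_gt0.
  have := few_large_degree prG e_ge0 degZ.
  move=> /le_trans/(_ (ler_wpM2l (sqr_ge0 _) cardD)).
  have -> : (b / 10 * (u1 * #|M|%:R)) ^+ 2 * #|Z|%:R
      = (b / 10) ^+ 2 * (u1 * #|M|%:R) * #|Z|%:R * (u1 * #|M|%:R) :> R by ring.
  rewrite ler_pM2r // => /(exceptional_count_le x0 u1_ge cM (ler0n _ _)).
  by move=> /le_trans; apply; rewrite ler_wpM2l.
have inner y : y \in A -> \sum_(z in B) (red y z * codeg y z)%:R <=
    u1 * u2 * #|M|%:R * (deg red B y)%:R + #|M|%:R * (30 * b ^+ 9 * #|B|%:R)
      + (y \in Y)%:R * (#|M|%:R * #|B|%:R).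
  move=> yA; have u_ge0 : 0 <= u1 * u2 * #|M|%:R.
    by rewrite !mulr_ge0 // ltW.
  have codeg_le z : (codeg y z)%:R <= #|M|%:R :> R.
    rewrite ler_nat; apply: subset_leq_card; apply/subsetP=> x.
    by rewrite inE => /andP[].
  have M_ge0 := ltW M_gt0.
  have [yY|yY] := boolP (y \in Y).
    apply: le_trans (_ : \sum_(z in B) #|M|%:R <= _).
      apply: ler_sum => z _; apply: le_trans (codeg_le z).
      by rewrite ler_nat; case: red; rewrite ?mul1n ?mul0n.
    rewrite sumr_const -[_ *+ #|B|]mulr_natr mulr1n mul1r lerDr.
    by apply: addr_ge0; [exact: mulr_ge0 | apply: mulr_ge0 => //; exact: mulr_ge0].
  rewrite mul0r addr0; pose Z := [set z in B | u1 * u2 * #|M|%:R < (codeg y z)%:R].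
  apply: le_trans (_ : _ <= \sum_(z in B) (u1 * u2 * #|M|%:R * (red y z)%:R
                              + #|M|%:R * (z \in Z)%:R)) _.
    apply: ler_sum => z zB; rewrite natrM inE zB /=.
    case: (red y z); rewrite ?mul0r ?mul1r ?mulr1; last first.
      by rewrite mulr0 add0r mulr_ge0.
    by case: ltP => [_|le_u]; rewrite ?mulr1 ?mulr0 ?addr0 // ler_wpDl.
  rewrite big_split /= -!mulr_sumr -!natr_sum -degE lerD2l ler_wpM2l //.
  apply: le_trans (cardZ y yA yY); rewrite ler_nat -sum1_card.
  rewrite big_mkcond [leqRHS]big_mkcond.
  by apply: leq_sum => z _; rewrite /Z inE; case: (z \in B); case: (_ < _).
apply: le_trans; first by apply: ler_sum => y yA; apply: inner.
rewrite !big_split /= sumr_const -mulr_sumr -mulr_suml -!natr_sum -/(pairs red A B).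
have -> : (\sum_(y in A) (y \in Y) = #|Y|)%N.
  rewrite -sum1_card big_mkcond [RHS]big_mkcond; apply: eq_bigr => y _.
  by rewrite /Y inE; case: (y \in A) => //=; case: (_ < _).
rewrite -mulr_natr.
have := ler_wpM2r (mulr_ge0 (ltW M_gt0) (ler0n R #|B|)) cardY; lra.
Qed.

Definition pair_density (A B : {set G}) : R :=
  (pairs red A B)%:R / (#|A|%:R * #|B|%:R).

Lemma pair_density_ge0 A B : 0 <= pair_density A B.
Proof. by rewrite divr_ge0 // mulr_ge0. Qed.

(** The sum ranges over ordered pairs, so each edge of H counts twice. *)
Definition potential t C : R :=
  \sum_(i | (t <= r i)%N) \sum_(j | (t <= r j)%N && edge i j)
    pair_density (C i) (C j).

Let blue : rel G := fun x y => edge x y && ~~ red x y.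

Lemma few_exceptional_vertices m C : large (r m) C ->
  #|[set x in C m | [exists j, (r m < r j)%N &&
     ((deg (adj (edge m j)) (C j) x)%:R
        < (adj_density p (edge m j) - b / 10) * #|C j|%:R)]]|%:R
  <= 100 * K * b ^+ 10 * #|C m|%:R.
Proof.
move=> largeC; set Z := [set _ in _ | _]; have b0 := b_gt0.
pose X j := [set x in Z | (r m < r j)%N &&
     ((deg (adj (edge m j)) (C j) x)%:R
        < (adj_density p (edge m j) - b / 10) * #|C j|%:R)].
have [|j ZX] := @pigeonhole_cover H G m Z X.
  move=> x xZ; move: (xZ); rewrite inE => /andP[_ /existsP[j jP]].
  by exists j; rewrite inE xZ.
have cCm := large_ge largeC (leqnn _).
have [X0|[x0]] := set_0Vmem (X j).
  move: ZX; rewrite X0 cards0 muln0 leqn0 => /eqP->.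
  by rewrite !mulr_ge0 ?exprn_ge0 // ltW.
rewrite inE => /and3P[_ mj _].
have cC := large_ge largeC (ltnW mj).
have Cj_gt0 := lt_le_trans c_gt0 cC.
have e_ge0 : 0 <= b / 10 * #|C j|%:R by rewrite mulr_ge0 // divr_ge0 // ltW.
have degX x : x \in X j -> (deg (adj (edge m j)) (C j) x)%:R
    <= adj_density p (edge m j) * #|C j|%:R - b / 10 * #|C j|%:R.
  by rewrite inE -mulrBl => /and3P[_ _ /ltW].
have := few_small_degree prG e_ge0 degX.
move=> /le_trans/(_ (ler_wpM2r (ltW Cj_gt0) (lambda_sqr_le x0))).
have -> : (b / 10 * #|C j|%:R) ^+ 2 * #|X j|%:R
    = b ^+ 2 / 100 * #|C j|%:R * #|X j|%:R * #|C j|%:R :> R by field.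
rewrite ler_pM2r // => leX.
have coef_gt0 : 0 < b ^+ 2 / 100 * c.
  by rewrite mulr_gt0 // divr_gt0 // exprn_gt0.
have {}leX : #|X j|%:R <= 100 * b ^+ 10 * c.
  rewrite -(ler_pM2l coef_gt0); apply: le_trans (le_trans leX _).
    apply: ler_wpM2r => //; apply: ler_wpM2l => //.
    by rewrite divr_ge0 // exprn_ge0 // ltW.
  by rewrite le_eqVlt; apply/orP; left; apply/eqP; field.
apply: le_trans (_ : K * #|X j|%:R <= _); first by rewrite -natrM ler_nat.
apply: le_trans (_ : K * (100 * b ^+ 10 * c) <= _); first by rewrite ler_wpM2l.
have -> : 100 * K * b ^+ 10 * #|C m|%:R = K * (100 * b ^+ 10 * #|C m|%:R) by ring.
by rewrite ler_wpM2l // ler_wpM2l // mulr_ge0 // exprn_ge0 // ltW.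
Qed.

(** Both densities are at least (10/3) |H| b, so changing them by b/10 or b/5
    changes them by a factor 1 + O(1/|H|) only. *)
Lemma adj_ratio_le sg1 sg2 :
  (adj_density p sg1 + b / 10) * (adj_density p sg2 + b / 10) <=
  (1 + 21 / 100 / K)
    * ((adj_density p sg1 - b / 5) * (adj_density p sg2 - b / 5)).
Proof.
pose hi sg := adj_density p sg + b / 10.
pose lo sg := adj_density p sg - b / 5.
rewrite -!/(hi _) -!/(lo _); have [[b0 b1] K1] := (b_gt0, b_le, cardH_ge1).
pose v := K^-1; have v_gt0 : 0 < v by rewrite invr_gt0 (lt_le_trans _ K1).
have v_le1 : v <= 1 by rewrite invf_le1 // (lt_le_trans _ K1).
have Kv : K * v = 1 by rewrite divff // gt_eqF // (lt_le_trans _ K1).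
have hi_le sg : hi sg <= (1 + v / 10) * lo sg.
  have pi_ge : 10 / 3 * K * b <= adj_density p sg.
    have Kb_ge0 : 0 <= K * b by rewrite mulr_ge0 // ltW.
    by rewrite /adj_density; case: sg; move: p_le; rewrite pE; lra.
  have : 10 / 3 * b <= v * adj_density p sg.
    have := ler_wpM2l (ltW v_gt0) pi_ge.
    have -> : v * (10 / 3 * K * b) = 10 / 3 * (K * v) * b by ring.
    by rewrite Kv; lra.
  have : v * b <= b by rewrite ler_piMl // ltW.
  by rewrite /hi /lo; lra.
have lo_ge0 sg : 0 <= lo sg by have := density_ge sg; rewrite /lo; lra.
have hi_ge0 sg : 0 <= hi sg by have := density_ge sg; rewrite /hi; lra.
apply: le_trans (ler_pM (hi_ge0 _) (hi_ge0 _) (hi_le sg1) (hi_le sg2)) _.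
rewrite mulrACA; apply: ler_wpM2r; first by rewrite mulr_ge0.
by rewrite -/v; nra.
Qed.

Lemma potential_split m C :
  \sum_(i | (r m < r i)%N) \sum_(j | (r m < r j)%N && edge i j)
      pair_density (C i) (C j)
    + \sum_(j | (r m < r j)%N && edge m j) pair_density (C m) (C j)
  <= potential (r m) C.
Proof.
have dens_ge0 := pair_density_ge0.
rewrite /potential [leRHS](bigD1 m) //= [leLHS]addrC; apply: lerD.
  by apply: ler_sum_subpred => // j /andP[/ltnW-> ->].
apply: le_trans (_ : \sum_(i | (r m < r i)%N)
  \sum_(j | (r m <= r j)%N && edge i j) pair_density (C i) (C j) <= _).
  by apply: ler_sum => i _; apply: ler_sum_subpred => // j /andP[/ltnW-> ->].
apply: ler_sum_subpred => [i mi|i]; last exact: sumr_ge0.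
by rewrite (ltnW mi); apply: contraTneq mi => ->; rewrite ltnn.
Qed.

(** F(x) bounds the next potential if x is chosen, plus the relative red degrees
    of x into the candidate sets of later neighbors. The second part has
    average at most the terms of the current potential that involve m, so the
    average of F over all candidates is at most (1 + O(1/|H|)) times the
    current potential, up to the exceptional pairs. The induction bound
    2 |H|^2 b^4 (|H| + t) increases with t just enough for this, and for
    excluding the few candidates with too small a degree. Since F(x) is below
    b/10, removing the red neighbors of x costs a further b/10 of a candidate
    set, whence the proportion [lo]. *)
Lemma potential_step m C : large (r m) C ->
  potential (r m) C <= 2 * K ^+ 2 * b ^+ 4 * (K + (r m)%:R) ->
  exists2 x, x \in C m &
    let C' j := [set y in C j | fits blue m j x y] in
    large (r m).+1 C' /\
    potential (r m).+1 C' <= 2 * K ^+ 2 * b ^+ 4 * (K + (r m).+1%:R).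
Proof.
move=> largeC potC; have [[b0 b1] K1] := (b_gt0, b_le, cardH_ge1).
have cCm := large_ge largeC (leqnn _).
have Cm_gt0 := lt_le_trans c_gt0 cCm.
have C_gt0 j : (r m <= r j)%N -> 0 < #|C j|%:R :> R.
  by move=> mj; apply: lt_le_trans c_gt0 (large_ge largeC mj).
have [x0 _] : exists x, x \in C m by apply/set0Pn; rewrite -card_gt0 -(ltr0n R).
have bc := bc_ge x0.
pose lo j := adj_density p (edge m j) - b / 5.
have lo_ge j : 3 * b <= lo j by have := density_ge (edge m j); rewrite /lo; lra.
have lo_gt0 j : 0 < lo j by have := lo_ge j; lra.
(* E x j is what adjacency alone leaves of C j, before red neighbors go. *)
pose E x j := nbhd (edge m j) (C j) x.
pose F1 x i j : R := (pairs red (E x i) (E x j))%:R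
  / (lo i * lo j * (#|C i|%:R * #|C j|%:R)).
pose F2 x j : R := (deg red (C j) x)%:R / #|C j|%:R.
pose F x := \sum_(i | (r m < r i)%N)
   \sum_(j | (r m < r j)%N && edge i j) F1 x i j
   + \sum_(j | (r m < r j)%N && edge m j) F2 x j.
have F1_ge0 x i j : 0 <= F1 x i j.
  by rewrite divr_ge0 // !mulr_ge0 // ltW.
have F2_ge0 x j : 0 <= F2 x j by rewrite divr_ge0.
have F_ge0 x : 0 <= F x.
  by rewrite addr_ge0 ?sumr_ge0 // => i _; apply: sumr_ge0.
pose ratio := 1 + 21 / 100 / K : R.
have ratio_ge1 : 1 <= ratio by rewrite lerDl divr_ge0 ?divr_ge0.
have sumF1 i j : (r m < r i)%N -> (r m < r j)%N ->
    \sum_(x in C m) F1 x i j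
      <= #|C m|%:R * (ratio * pair_density (C i) (C j) + 7 * b ^+ 7).
  move=> mi mj.
  have := codegree_pairs (edge m i) (edge m j) cCm (large_ge largeC (ltnW mi))
    (large_ge largeC (ltnW mj)).
  have a_gt0 : 0 < #|C i|%:R * #|C j|%:R :> R by rewrite mulr_gt0 // C_gt0 // ltnW.
  have den_gt0 : 0 < lo i * lo j * (#|C i|%:R * #|C j|%:R) by rewrite mulr_gt0 // mulr_gt0.
  rewrite /F1 -mulr_suml ler_pdivrMr // => /le_trans; apply.
  rewrite -[leRHS]mulrA; apply: ler_wpM2l; first exact: ltW.
  have -> : (ratio * pair_density (C i) (C j) + 7 * b ^+ 7)
        * (lo i * lo j * (#|C i|%:R * #|C j|%:R))
      = ratio * (lo i * lo j) * (pairs red (C i) (C j))%:R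
        + 7 * b ^+ 7 * (lo i * lo j) * (#|C i|%:R * #|C j|%:R).
    by rewrite /pair_density; field; rewrite !gt_eqF // C_gt0 // ltnW.
  apply: lerD; first by apply: ler_wpM2r => //; apply: adj_ratio_le.
  apply: ler_wpM2r; first exact: ltW.
  have b9_gt0 : 0 < b ^+ 9 by rewrite exprn_gt0.
  apply: le_trans (_ : 7 * b ^+ 7 * (3 * b * (3 * b)) <= _).
    by rewrite (_ : 7 * b ^+ 7 * (3 * b * (3 * b)) = 63 * b ^+ 9); [lra|ring].
  by rewrite ler_wpM2l ?ler_pM ?mulr_ge0 ?exprn_ge0 ?(ltW b0).
have sumF : \sum_(x in C m) F x
    <= #|C m|%:R * (ratio * potential (r m) C + 7 * K ^+ 2 * b ^+ 7).
  rewrite /F big_split /= exchange_big /= [X in _ + X]exchange_big /=.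
  under eq_bigr do rewrite exchange_big /=.
  have M_ge0 := ltW Cm_gt0.
  have b7_ge0 : 0 <= 7 * b ^+ 7 by rewrite mulr_ge0 // exprn_ge0 // ltW.
  apply: le_trans (_ : #|C m|%:R * (ratio * (\sum_(i | (r m < r i)%N)
      \sum_(j | (r m < r j)%N && edge i j) pair_density (C i) (C j)
    + \sum_(j | (r m < r j)%N && edge m j) pair_density (C m) (C j))
      + 7 * K ^+ 2 * b ^+ 7) <= _); last first.
    rewrite ler_wpM2l // lerD2r ler_wpM2l //; first exact: le_trans ratio_ge1.
    exact: potential_split.
  rewrite [ratio * (_ + _)]mulrDr addrAC mulrDr lerD //.
    have -> : 7 * K ^+ 2 * b ^+ 7 = \sum_(i : H) \sum_(j : H) (7 * b ^+ 7).
      by rewrite !sumr_const -[_ *+ _ *+ _]mulr_natr -[_ *+ _]mulr_natr; ring.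
    apply: le_trans (_ : #|C m|%:R * \sum_(i | (r m < r i)%N)
        \sum_(j | (r m < r j)%N && edge i j)
           (ratio * pair_density (C i) (C j) + 7 * b ^+ 7) <= _).
      rewrite mulr_sumr; apply: ler_sum => i mi; rewrite mulr_sumr.
      by apply: ler_sum => j /andP[mj _]; apply: sumF1.
    rewrite ler_wpM2l //; under eq_bigr do rewrite big_split /=.
    rewrite big_split /= lerD //.
      by rewrite mulr_sumr; apply: ler_sum => i _; rewrite mulr_sumr.
    apply: le_trans (_ : \sum_(i | (r m < r i)%N) \sum_(j : H) (7 * b ^+ 7) <= _).
      by apply: ler_sum => i _; apply: ler_sum_subpred.
    by apply: ler_sum_subpred => // i; apply: sumr_ge0.
  rewrite !mulr_sumr; apply: ler_sum => j /andP[mj _].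
  have dens_ge0 := pair_density_ge0 (C m) (C j).
  apply: le_trans (_ : #|C m|%:R * pair_density (C m) (C j) <= _).
    rewrite /F2 -mulr_suml -natr_sum -/(pairs red (C m) (C j)) /pair_density.
    rewrite le_eqVlt; apply/orP; left; apply/eqP; field.
    by rewrite !gt_eqF // C_gt0 // ltnW.
  by rewrite ler_wpM2l // ler_peMl.
have Bt : (r m)%:R + 1 <= K by rewrite -(natrD _ _ 1) addn1 ler_nat.
have t_ge0 : 0 <= (r m)%:R :> R by [].
have [x [xC x_ok FB]] : exists x, [/\ x \in C m,
    x \notin [set x in C m | [exists j, (r m < r j)%N &&
     ((deg (adj (edge m j)) (C j) x)%:R
        < (adj_density p (edge m j) - b / 10) * #|C j|%:R)]] &
    F x <= 2 * K ^+ 2 * b ^+ 4 * (K + (r m).+1%:R)].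
  apply: exists_small_value sumF _ (few_exceptional_vertices largeC) _ => //.
    by rewrite !mulr_ge0 ?addr_ge0 ?exprn_ge0 // ltW.
  have v_gt0 : 0 < K^-1 by rewrite invr_gt0 (lt_le_trans _ K1).
  have tK : ratio * (K + (r m)%:R) <= K + (r m)%:R + 42 / 100.
    have Kv : K^-1 * K = 1 by rewrite mulVf // gt_eqF // (lt_le_trans _ K1).
    have : K^-1 * (r m)%:R <= 1.
      by rewrite -[leRHS]Kv; apply: ler_wpM2l; [exact: ltW | lra].
    by rewrite /ratio; move: Kv; lra.
  have b3 : b ^+ 3 <= b by rewrite exprS ler_piMr ?exprn_ile1 ?(ltW b0) //; lra.
  have b8 : b ^+ 8 <= b by rewrite exprS ler_piMr ?exprn_ile1 ?(ltW b0) //; lra.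
  have p2 : p ^+ 2 <= 1 by rewrite exprn_ile1 ?(ltW p_gt0) //; move: p_le; lra.
  have theta_le : (K + (r m)%:R + 1) * (100 * K * b ^+ 10) <= 2 * b ^+ 8.
    apply: le_trans (_ : 2 * K * (100 * K * b ^+ 10) <= _).
      apply: ler_wpM2r; last by lra.
      by rewrite !mulr_ge0 ?exprn_ge0 // ltW.
    have -> : 2 * K * (100 * K * b ^+ 10) = p ^+ 2 * (2 * b ^+ 8) by rewrite pE; ring.
    by rewrite ler_piMl // mulr_ge0 // exprn_ge0 // ltW.
  have Q_gt0 : 0 < 2 * K ^+ 2 * b ^+ 4.
    by rewrite !mulr_gt0 ?exprn_gt0 // (lt_le_trans _ K1).
  rewrite [ltRHS]mulrA [ltRHS]mulrC ltr_pM2l //.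
  apply: le_lt_trans (_ : ratio * (2 * K ^+ 2 * b ^+ 4 * (K + (r m)%:R))
      + 7 * K ^+ 2 * b ^+ 7 < _).
    by rewrite lerD2r ler_wpM2l // (le_trans _ ratio_ge1).
  have -> : ratio * (2 * K ^+ 2 * b ^+ 4 * (K + (r m)%:R)) + 7 * K ^+ 2 * b ^+ 7
      = 2 * K ^+ 2 * b ^+ 4 * (ratio * (K + (r m)%:R) + 7 / 2 * b ^+ 3) by field.
  rewrite -[ltRHS]mulrA ltr_pM2l // -[(r m).+1%:R]natr1.
  by move: tK theta_le; lra.
have deg_ge j : (r m < r j)%N ->
    (adj_density p (edge m j) - b / 10) * #|C j|%:R
      <= (deg (adj (edge m j)) (C j) x)%:R.
  move=> mj; rewrite leNgt; apply: contra x_ok => lt_deg.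
  by rewrite inE xC; apply/existsP; exists j; rewrite mj.
have B_le : 2 * K ^+ 2 * b ^+ 4 * (K + (r m).+1%:R) <= b / 10.
  have p3 : p ^+ 3 <= 1 by rewrite exprn_ile1 ?(ltW p_gt0) //; move: p_le; lra.
  apply: le_trans (_ : 2 * K ^+ 2 * b ^+ 4 * (2 * K) <= _).
    apply: ler_wpM2l; first by rewrite !mulr_ge0 ?exprn_ge0 // ltW.
    by rewrite -[(r m).+1%:R]natr1; lra.
  have -> : 2 * K ^+ 2 * b ^+ 4 * (2 * K) = p ^+ 3 * b / 250 by rewrite pE; field.
  have : p ^+ 3 * b <= b by rewrite ler_piMl // ltW.
  by lra.
exists x => // C'.
have C'_ge j : (r m < r j)%N -> lo j * #|C j|%:R <= #|C' j|%:R.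
  move=> mj; rewrite /C' card_fits; last by move=> y z /andP[].
  move: (deg_ge j mj); rewrite /lo; case: ifP => m_j.
    have : F2 x j <= b / 10.
      apply: le_trans (le_trans FB B_le).
      rewrite /F [X in _ + X](bigD1 j) /= ?mj ?m_j // addrCA lerDl.
      by rewrite addr_ge0 ?sumr_ge0 // => i _; apply: sumr_ge0.
    rewrite /F2 ler_pdivrMr ?C_gt0 1?ltnW // => red_le.
    have : (deg (adj true) (C j) x)%:R
        <= (deg blue (C j) x)%:R + (deg red (C j) x)%:R :> R.
      rewrite -natrD ler_nat !degE -big_split; apply: leq_sum => y _.
      by rewrite /adj /blue; case: edge; case: red.
    by lra.
  have : (deg (adj false) (C j) x)%:R
       <= (deg (adj false) (C j) x - (x \in C j))%:R + 1 :> R.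
    rewrite -(natrD _ _ 1) ler_nat addn1.
    by case: (x \in C j); rewrite ?subn0 ?subn1 ?leqSpred.
  have : 10 <= b * #|C j|%:R.
    by apply: le_trans bc _; rewrite ler_wpM2l ?(ltW b0) // (large_ge largeC) // ltnW.
  lra.
split.
  apply: large_step largeC _ => j mj; apply: le_trans (C'_ge j mj).
  apply: ler_wpM2r => //; have := lo_ge j; rewrite /lo; case: ifP => m_j lo_m.
    apply: le_trans lo_m; have : b ^+ 4 <= b.
      by rewrite exprS ler_piMr ?exprn_ile1 ?(ltW b0) //; lra.
    by lra.
  have : b <= K * b by rewrite ler_peMl // ltW.
  by rewrite /adj_density pE; lra.
apply: le_trans FB; rewrite -[leLHS]addr0 lerD ?sumr_ge0 //.
apply: ler_sum => i mi; apply: ler_sum => j /andP[mj _].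
have C'E k : C' k \subset E x k.
  apply/subsetP=> y; rewrite !inE => /andP[-> /andP[_]]; rewrite /adj.
  by case: (edge m k) => [/andP[->]|/negbTE->].
apply: ler_pM; [by [] | by rewrite invr_ge0 mulr_ge0 | |].
  by rewrite ler_nat pairs_subset.
have C'_gt0 k : (r m < r k)%N -> 0 < #|C' k|%:R :> R.
  move=> mk; apply: lt_le_trans (C'_ge k mk).
  by rewrite mulr_gt0 // C_gt0 // ltnW.
have lo_ge0 k : 0 <= lo k * #|C k|%:R by rewrite mulr_ge0 // ltW.
rewrite lef_pV2 ?posrE ?mulr_gt0 ?C'_gt0 ?C_gt0 ?(ltnW mi) ?(ltnW mj) //.
by rewrite mulrACA ler_pM ?C'_ge.
Qed.

(** Initially each of the at most |H|^2 terms of the potential is at most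
    2 |H| b^4, which is the bound of [potential_step] at t = 0. *)
Lemma embedding_in_sparse_family (W : H -> {set G}) :
  (forall j, w <= #|W j|%:R) ->
  (forall i j, edge i j ->
     (pairs red (W i) (W j))%:R <= 2 * K * b ^+ 4 * (#|W i|%:R * #|W j|%:R)) ->
  exists f : H -> G, forall i j, i != j -> fits blue i j (f i) (f j).
Proof.
move=> wW redW.
have W_gt0 j : 0 < #|W j|%:R :> R := lt_le_trans w_gt0 (wW j).
have [i0 _] : exists i : H, i \in H by apply/card_gt0P.
have [x0 _] : exists x, x \in W i0.
  by apply/set0Pn; rewrite -card_gt0 -(ltr0n R).
pose Inv t C := large t C /\ potential t C <= 2 * K ^+ 2 * b ^+ 4 * (K + t%:R).
apply: (@greedy_choice H G x0 (@fits G H blue) r Inv _ _ _ _ W) => //.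
- by apply: fits_sym => x y; rewrite /blue edge_sym red_sym.
- by move=> m C [largeC potC]; apply: potential_step.
split; first exact: large_candidates0.
rewrite addr0; have -> : 2 * K ^+ 2 * b ^+ 4 * K
    = \sum_(i : H) \sum_(j : H) (2 * K * b ^+ 4).
  rewrite !sumr_const -[_ *+ _ *+ _]mulr_natr -[_ *+ _]mulr_natr; ring.
apply: ler_sum => i _; rewrite [leRHS](bigID (fun j => edge i j)) /=.
rewrite -[leLHS]addr0 lerD ?sumr_ge0 //.
  apply: ler_sum => j ij; rewrite /pair_density ler_pdivrMr ?mulr_gt0 //.
  exact: redW.
by move=> j _; rewrite !mulr_ge0 ?exprn_ge0 // ltW // b_gt0.
Qed.

End SparseParts.

End Embedding.

(** * Exponents and colorings *)

Section Numerics.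
Variable R : realType.

(** The left side is convex in p, and the right side is its chord from p = 0 to
    p = 3/4, where 2^(-3) = 1/8. *)
Lemma two_powRN_le (p : R) : 0 <= p -> p <= 3 / 4 ->
  2 `^ (- (4 * p)) <= 1 - 7 / 6 * p.
Proof.
move=> p_ge0 p_le.
have t0 : 0 <= 4 / 3 * p by lra.
have t1 : 4 / 3 * p <= 1 by lra.
have := convex_expR (Itv01 t0 t1) (- (3%:R * ln (2 : R))) 0.
rewrite !convRE /= expR0 expRN expRM_natl lnK ?posrE // /unstable.onem.
rewrite /powR pnatr_eq0 /= mulr0 addr0 => convex.
rewrite (_ : - (4 * p) * ln 2 = 4 / 3 * p * - (3 * ln 2)); last by field.
by apply: le_trans convex _; lra.
Qed.

Lemma log2_ge (m chi : nat) : (2 ^ m <= chi)%N -> m%:R <= log2 (chi%:R : R).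
Proof.
move=> le_chi; have ln2_gt0 : 0 < ln (2 : R) by rewrite ln_gt0 // ltr1n.
have chi_gt0 : 0 < chi%:R :> R by rewrite ltr0n (leq_trans _ le_chi) // expn_gt0.
rewrite /log2 ler_pdivlMr // mulr_natl -lnXn // ler_ln ?posrE ?exprn_gt0 //.
by rewrite -natrX ler_nat.
Qed.

(** log chi is at least h - 1 and at least 1, so that
    20 log chi >= 5 (h - 1) + 15. *)
Lemma powR_log2_le (q : R) (h chi : nat) : 0 < q <= 1 -> (1 < chi)%N ->
  (2 ^ h.-1 <= chi)%N -> q `^ (20 * log2 chi%:R) <= q ^+ (5 * h + 10).
Proof.
move=> /[dup] q01 /andP[q_gt0 q_le1] chi_gt1 h_le.
rewrite -powR_mulrn ?(ltW q_gt0) //; apply: (ger_powR q01).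
have := log2_ge h_le; have := @log2_ge 1 chi chi_gt1.
rewrite natrD natrM; case: h h_le => [|h] _ /=; first by rewrite mulr0; lra.
by rewrite -natr1; lra.
Qed.

End Numerics.

Lemma colorable_mono (H : sgraph) m m' : (m <= m')%N ->
  colorable H m -> colorable H m'.
Proof.
move=> mm' /existsP[f fP]; apply/existsP; exists [ffun x => widen_ord mm' (f x)].
apply/forallP=> x; apply/forallP=> y; apply/implyP=> xy; rewrite !ffunE.
by have /implyP/(_ xy) := forallP (forallP fP x) y.
Qed.

Lemma colorable_card (H : sgraph) : colorable H #|H|.
Proof.
apply/existsP; exists [ffun x => enum_rank x].
apply/forallP => x; apply/forallP => y; apply/implyP => xy.
rewrite !ffunE (inj_eq enum_rank_inj); apply: contraTneq xy => ->.
by rewrite edge_irrefl.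
Qed.

Lemma chromatic_colorable (H : sgraph) m : (chromatic_number H <= m)%N ->
  colorable H m.
Proof.
by move=> le_m; apply: colorable_mono le_m _; rewrite /chromatic_number; case: ex_minnP.
Qed.

Lemma chromatic_le_card (H : sgraph) : (chromatic_number H <= #|H|)%N.
Proof.
rewrite /chromatic_number; case: ex_minnP => m _; apply; exact: colorable_card.
Qed.

(** * The theorem *)

Theorem theorem5p4 (R : realType) (k d chi n : nat) (G : sgraph) (p lambda : R)
    (k_gt0 : (0 < k)%N) (d_gt0 : (0 < d)%N) (chi_ge2 : (2 <= chi)%N)
    (n_gt0 : (0 < n)%N) (cardG : #|G| = n)
    (p_gt0 : 0 < p) (p_le : p <= 3 / 4)
    (prG : pseudo_random G p lambda)
    (lambda_le : lambda <=
       ((p / (10 * k%:R)) ^+ d * 2 `^ (- (p * k%:R))) `^ (20 * log2 chi%:R)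
       * n%:R) :
  (forall (H : sgraph), #|H| = k -> degenerate d H ->
     (chromatic_number H <= chi)%N ->
     forall c : {set G} -> bool, induced_mono_copy c H) /\
  (forall c : {set G} -> bool, exists b : bool,
     forall (H : sgraph), #|H| = k -> degenerate d H ->
       (chromatic_number H <= chi)%N -> induced_copy_in_color c b H).
Proof.
suff all_in_color (c : {set G} -> bool) : exists b : bool,
    forall (H : sgraph), #|H| = k -> degenerate d H ->
      (chromatic_number H <= chi)%N -> induced_copy_in_color c b H.
  split=> // H Hk degH chiH c; have [b bP] := all_in_color c.
  by exists b; apply: bP.
pose b := p / (10 * k%:R); pose q := b ^+ d * 2 `^ (- (p * k%:R)).
(* More than k colors are never needed, and 2 <= chi' keeps h positive. *)
pose chi' := maxn 2 (minn chi k); pose h := up_log 2 chi'.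
have k_ge1 : 1 <= k%:R :> R by rewrite ler1n.
have pE : p = 10 * k%:R * b by rewrite /b; field; rewrite gt_eqF // ltr0n.
have b_gt0 : 0 < b by rewrite divr_gt0 // mulr_gt0 // ltr0n.
have b_le1 : b <= 1.
  by rewrite ler_pdivrMr ?mulr_gt0 ?ltr0n // mul1r; lra.
have pow_gt0 : 0 < 2 `^ (- (p * k%:R)) :> R by rewrite powR_gt0.
have pow_le1 : 2 `^ (- (p * k%:R)) <= 1 :> R.
  rewrite powRN invf_le1 ?powR_gt0 // -[leLHS](@powRr0 R 2).
  by rewrite ler_powR ?mulr_ge0 ?ler1n // ltW.
have q_gt0 : 0 < q by rewrite mulr_gt0 // exprn_gt0.
have q_le_b : q <= b.
  case: (d) d_gt0 @q q_gt0 => // d' _ q q_gt0.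
  rewrite /q exprS -mulrA ler_piMr ?(ltW b_gt0) //.
  by rewrite mulr_ile1 ?exprn_ge0 ?exprn_ile1 ?(ltW b_gt0) ?(ltW pow_gt0).
have q_le1 : q <= 1 := le_trans q_le_b b_le1.
have beta_ge : (2 `^ (- (p * k%:R))) ^+ 4 <= (1 - 7 / 6 * p) ^+ k.
  have -> : (2 `^ (- (p * k%:R))) ^+ 4 = (2 `^ (- (4 * p))) ^+ k :> R.
    rewrite -!powR_mulrn ?powR_ge0 // -!powRrM; congr (_ `^ _); ring.
  by rewrite lerXn2r ?nnegrE ?powR_ge0 ?two_powRN_le ?(ltW p_gt0) //; lra.
have q4_le : q ^+ 4 <= (b ^+ 4) ^+ d * (1 - 7 / 6 * p) ^+ k.
  rewrite /q exprMn exprAC; apply: ler_wpM2l => //.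
  by rewrite !exprn_ge0 // ltW.
have chi'_gt1 : (1 < chi')%N by rewrite leq_max.
have h_gt0 : (0 < h)%N by rewrite up_log_gt0.
have h_lt : (2 ^ h.-1 < chi')%N by rewrite up_log_gtn.
have chi'_le : (chi' <= 2 ^ h)%N by rewrite up_logP.
have pow_h : (2 ^ h <= 2 * k)%N.
  rewrite -(prednK h_gt0) expnS leq_pmul2l //.
  move: h_lt; rewrite leq_max ltnS leq_min => /orP[|/andP[_ /ltnW]] //.
  by move=> /leq_trans; apply.
have lambda_le_q : lambda <= q ^+ (5 * h + 10) * n%:R.
  apply: le_trans lambda_le _; rewrite ler_wpM2r // powR_log2_le ?q_gt0 //.
  by apply: leq_trans (ltnW h_lt) _; rewrite geq_max chi_ge2 geq_minl.
pose M := (q ^+ 5) ^+ h * n%:R.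
have M_gt0 : 0 < M by rewrite mulr_gt0 ?exprn_gt0 ?ltr0n.
have lambda_le_b w : M <= w -> lambda <= b ^+ 6 * (q ^+ 4 * w).
  move=> Mw; apply: le_trans lambda_le_q _.
  have -> : q ^+ (5 * h + 10) * n%:R = q ^+ 6 * (q ^+ 4 * M).
    by rewrite /M exprD exprM; ring.
  have q_ge0 := ltW q_gt0; have b_ge0 := ltW b_gt0.
  apply: ler_pM; first exact: exprn_ge0.
  - by apply: mulr_ge0; [exact: exprn_ge0 | exact: ltW].
  - by rewrite lerXn2r ?nnegrE.
  - by apply: ler_wpM2l => //; exact: exprn_ge0.
have [all_true|] := pselect (forall H : sgraph, #|H| = k -> degenerate d H ->
    (chromatic_number H <= chi)%N -> induced_copy_in_color c true H).
  by exists true.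
move=> /existsNP[H0 /not_implyP[H0k /not_implyP[degH0 /not_implyP[_ noH0]]]].
exists false => H Hk degH chiH.
pose red := color_class c true.
have red_sym : symmetric red := color_class_sym c true.
have red_edge : subrel red (@edge G) by move=> x y /andP[].
have split_pair (U : {set G}) : M <= #|U|%:R -> exists X Y : {set G},
    [/\ X \subset U, Y \subset U, 2 * q ^+ 5 * #|U|%:R <= #|X|%:R,
        2 * q ^+ 5 * #|U|%:R <= #|Y|%:R &
        forall x, x \in X -> (deg red Y x)%:R <= b ^+ 4 * #|Y|%:R].
  move=> MU; have U_gt0 := lt_le_trans M_gt0 MU.
  have [r [r_inj r_lt r_deg]] := degenerate_rank degH0.
  have H0_gt0 : (0 < #|H0|)%N by rewrite H0k.
  have c_gt0 : 0 < q ^+ 4 * #|U|%:R by rewrite mulr_gt0 ?exprn_gt0.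
  have c_le : q ^+ 4 * #|U|%:R
      <= (b ^+ 4) ^+ d * (1 - 7 / 6 * p) ^+ #|H0| * #|U|%:R.
    by rewrite H0k ler_wpM2r.
  have pE0 : p = 10 * #|H0|%:R * b by rewrite H0k.
  have [[f /induced_copy_of_fits]|] := embedding_or_sparse_pair prG p_gt0 p_le
    H0_gt0 r_inj r_lt r_deg pE0 c_gt0 c_le (lambda_le_b _ MU) red_sym red_edge
    (lexx _).
    by move=> /(_ c true) copyH0; case: noH0; apply: copyH0.
  have five : 2 * q ^+ 5 * #|U|%:R = 2 * q * (q ^+ 4 * #|U|%:R) by ring.
  have kq_le : 2 * (k%:R * q) <= 1.
    apply: le_trans (_ : 2 * (k%:R * b) <= _); first by rewrite ler_wpM2l // ler_wpM2l.
    by move: p_le; rewrite pE; lra.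
  have q2_le : 2 * q <= 1.
    by apply: le_trans kq_le; rewrite ler_wpM2l // ler_peMl // ltW.
  move=> [X [Y [XU YU cX cY degX]]]; exists X, Y; split=> //; rewrite five.
    have kR_gt0 : 0 < k%:R :> R by rewrite ltr0n.
    rewrite -(ler_pM2l kR_gt0); apply: le_trans (_ : q ^+ 4 * #|U|%:R <= _).
      rewrite (_ : k%:R * _ = 2 * (k%:R * q) * (q ^+ 4 * #|U|%:R)); last by ring.
      by rewrite ler_piMl ?(ltW c_gt0).
    by move: cX; rewrite H0k.
  by apply: le_trans cY; rewrite ler_piMl ?(ltW c_gt0).
have q5_gt0 : 0 < q ^+ 5 by rewrite exprn_gt0.
have q5_le1 : q ^+ 5 <= 1 by rewrite exprn_ile1 // ltW.
have b4_gt0 : 0 < b ^+ 4 by rewrite exprn_gt0.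
have [|s [size_s sP pw_s]] := sparse_family red_sym q5_gt0 q5_le1 b4_gt0 split_pair
  (h := h) (U := [set: G]).
  by rewrite cardsT cardG.
have /existsP[f f_col] : colorable H chi'.
  apply: chromatic_colorable; rewrite leq_max leq_min chiH -Hk.
  by rewrite chromatic_le_card orbT.
have f_lt i : (f i < size s)%N by rewrite size_s (leq_trans (ltn_ord _)).
have [r [r_inj r_lt r_deg]] := degenerate_rank degH.
have H_gt0 : (0 < #|H|)%N by rewrite Hk.
have c_gt0 : 0 < q ^+ 4 * M by rewrite mulr_gt0 ?exprn_gt0.
have c_le : q ^+ 4 * M <= (b ^+ 4) ^+ d * (1 - 7 / 6 * p) ^+ #|H| * M.
  by rewrite Hk ler_wpM2r // ltW.
have pEH : p = 10 * #|H|%:R * b by rewrite Hk.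
have [|i j ij|g] := @embedding_in_sparse_family R G H p lambda d r prG p_gt0 p_le
  H_gt0 r_inj r_lt r_deg b M _ pEH c_gt0 c_le (lambda_le_b _ (lexx _)) red red_sym
  (fun i => nth set0 s (f i)).
- by move=> i; have [_] := sP _ (mem_nth set0 (f_lt i)); rewrite cardsT cardG.
- have f_neq : f i != f j.
    by have /implyP/(_ ij) := forallP (forallP f_col i) j.
  have sparse_ij : sparse red ((2 ^ h)%:R * b ^+ 4)
      (nth set0 s (f i)) (nth set0 s (f j)).
    have /(pairwiseP set0) pw := pw_s.
    move: f_neq; rewrite -val_eqE neq_ltn => /orP[lt_ij|lt_ji].
      by apply: pw; rewrite ?inE.
    rewrite /sparse pairsC // [#|nth set0 s (f i)|%:R * _]mulrC.
    by apply: pw; rewrite ?inE.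
  apply: le_trans sparse_ij _; rewrite ler_wpM2r ?mulr_ge0 // ler_wpM2r ?(ltW b4_gt0) //.
  by rewrite Hk -natrM ler_nat.
apply: induced_copy_of_fits => x y /andP[xy]; rewrite /red /color_class xy /=.
by case: (c _).
Qed.
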